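(* There is an absolute constant $c>0$ such that the following holds. Let $V$ be a $(K,n)$ regular set in $\mathbb{R}^N$ with $[V]_N\leq t$. Then, for $\varepsilon>0$, $$\operatorname{Vol}(\mathbb{T}(V,\varepsilon)) \;\leq\; \mathcal{N}(V,\varepsilon)\cdot(2\varepsilon)^N\operatorname{Vol}(\mathcal{B}^N)\;\leq\; \operatorname{Vol}(\mathcal{B}^N)\,2^N\,\varepsilon^{N-n}\,K\cdot\big(c\,t\,N^{3/2}\,n\big)^n .$$
   Context: Regular sets: let $\overline{G}_N^k$ be the affine Grassmannian of $k$-dimensional affine subspaces (''planes'') of $\mathbb{R}^N$, equipped with the uniform measure $\mu=\mu_N^k$ invariant under rigid body transformations. A set $V\subseteq\mathbb{R}^N$ is a $(K,n)$ regular set in $\mathbb{R}^N$ if (1) for $\mu$-almost all planes $L$ of codimension $n'\le n$ in $\mathbb{R}^N$, $V\cap L$ has at most $K$ path connected components; and (2) for $\mu$-almost all planes $L$ of codimension $n'\geq n+1$ in $\mathbb{R}^N$, $V\cap L$ is empty. $[V]_N$ denotes the smallest $r\ge 0$ such that $V$ can be covered by a set that is a rigid body transformation of the cube $r\cdot[-1,1]^N$. $\mathcal{N}(V,\varepsilon)$ is the covering number of $V$: the minimal cardinality of a subset $S\subseteq V$ such that every $x\in V$ has some $y\in S$ with $\|x-y\|\le\varepsilon$ (Euclidean norm). $\mathcal{B}^N$ is the closed unit ball of $\mathbb{R}^N$, $\operatorname{Vol}$ is volume in $\mathbb{R}^N$, and $\mathbb{T}(V,\varepsilon)=\bigcup_{x\in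 V}B(x,\varepsilon)$ is the tubular neighborhood of $V$, where $B(x,\varepsilon)$ is the Euclidean ball of radius $\varepsilon$ centered at $x$.
   Formalization: The second inequality is stated only for 0 < ε ≤ diam(V), not for all ε > 0; as written it fails, e.g. for V = {0} in R^1 with K = n = 1, t = 0, or V = [-1,1] with t = 1 and ε > c. *)

(* Defs.v *)
From HB Require Import structures.
From mathcomp Require Import all_boot all_order all_algebra.
From mathcomp Require Import all_classical all_reals all_analysis.

Set Implicit Arguments.
Unset Strict Implicit.
Unset Printing Implicit Defensive.

Import Order.TTheory GRing.Theory Num.Theory.
Import numFieldNormedType.Exports.

Local Open Scope classical_set_scope.
Local Open Scope ring_scope.
Local Open Scope ereal_scope.

(* The library norm on 'rV[R]_N is the sup norm, hence this definition. *)
Definition enorm (R : realType) (N : nat) (x : 'rV[R]_N) : R :=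
  Num.sqrt (\sum_(i < N) x ord0 i ^+ 2)%R.

Definition eball (R : realType) (N : nat) (x : 'rV[R]_N) (r : R) :
    set 'rV[R]_N :=
  [set y | enorm (x - y) <= r]%R.

Definition tube (R : realType) (N : nat) (V : set 'rV[R]_N) (eps : R) :
    set 'rV[R]_N :=
  \bigcup_(x in V) eball x eps.

Definition ediam (R : realType) (N : nat) (V : set 'rV[R]_N) : \bar R :=
  ereal_sup [set (enorm (p.1 - p.2)%R)%:E | p in V `*` V].

(* The centres lie in V; the value is +oo when no finite set of centres
   works. *)
Definition covering_number (R : realType) (N : nat) (V : set 'rV[R]_N)
    (eps : R) : \bar R :=
  ereal_inf [set (k%:R : R)%:E | k in [set k : nat |
    exists S : set 'rV[R]_N, [/\ S `<=` V, (S #= `I_k)%card &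
      forall x, V x -> exists2 y, S y & (enorm (x - y) <= eps)%R]]].

Definition box (R : realType) (N : nat) (p : 'rV[R]_N * 'rV[R]_N) :
    set 'rV[R]_N :=
  [set x | forall i, (p.1 ord0 i <= x ord0 i <= p.2 ord0 i)%R].

(* The maximum makes the volume 0 when the box is empty. *)
Definition box_vol (R : realType) (N : nat) (p : 'rV[R]_N * 'rV[R]_N) : \bar R :=
  (\prod_(i < N) Num.max 0 (p.2 ord0 i - p.1 ord0 i))%R%:E.

(* Lebesgue outer measure on R^N: it is defined on all sets and coincides with
   volume on the Lebesgue measurable ones. Covers are countable sets of boxes
   rather than sequences, so that the empty cover is allowed: for N = 0 every
   box is the whole space and has volume 1. *)
Definition vol (R : realType) (N : nat) (A : set 'rV[R]_N) : \bar R :=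
  ereal_inf [set \esum_(p in C) box_vol p | C in
    [set C | countable C /\ A `<=` \bigcup_(p in C) box p]].

Section vol_outer_measure.
Context (R : realType) (N : nat).
Implicit Types (p : 'rV[R]_N * 'rV[R]_N) (A B : set 'rV[R]_N).

Let box_vol_ge0 p : 0 <= box_vol p.
Proof. by rewrite lee_fin prodr_ge0// => i _; rewrite le_max lexx. Qed.

Let vol_ge0 A : 0 <= vol A.
Proof.
by apply: le_ereal_inf_tmp => _ [C _ <-]; apply: esum_ge0 => p _.
Qed.

Let vol0 : vol (set0 : set 'rV[R]_N) = 0.
Proof.
apply/eqP; rewrite eq_le vol_ge0 andbT; apply: ereal_inf_lbound.
by exists set0; [split|rewrite esum_set0].
Qed.

Let le_vol : {homo (@vol R N) : A B / A `<=` B >-> A <= B}.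
Proof.
move=> A B AB; apply: ereal_inf_le_tmp => _ [C [cC BC] <-].
by exists C => //; split => //; exact: subset_trans BC.
Qed.

Let vol_sigma_subadditive : sigma_subadditive (@vol R N).
Proof.
move=> A; have [[i ioo]|] := pselect (exists i, vol (A i) = +oo).
  rewrite (eseries_pinfty _ _ ioo) ?leey// => n _.
  by rewrite -ltNye (lt_le_trans _ (vol_ge0 _)).
rewrite -forallNE => Aoo.
suff add2e (e : {posnum R}) :
    vol (\bigcup_n A n) <= \sum_(i <oo) vol (A i) + e%:num%:E.
  by apply/lee_addgt0Pr => _/posnumP[].
rewrite (le_trans _ (epsilon_trick _ _ _))//.
pose P n (C : set ('rV[R]_N * 'rV[R]_N)) :=
  [/\ countable C, A n `<=` \bigcup_(p in C) box p &
   \esum_(p in C) box_vol p <= vol (A n) + (e%:num / (2 ^ n.+1)%:R)%:E].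
have [G PG] : {G : nat -> set ('rV[R]_N * 'rV[R]_N) & forall n, P n (G n)}.
  apply: (@choice _ _ P) => n; rewrite /P.
  have en1 : (0 < e%:num / (2 ^ n.+1)%:R)%R by [].
  have Afin : vol (A n) \is a fin_num.
    by rewrite ge0_fin_numE// ltey; apply/eqP/Aoo.
  have [_ [C [cC AC] <-] lt] := lb_ereal_inf_adherent en1 Afin.
  by exists C; split => //; exact/ltW.
apply: (@le_trans _ _ (\esum_(p in \bigcup_n G n) box_vol p)).
  apply: ereal_inf_lbound; exists (\bigcup_n G n) => //; split.
    by apply: bigcup_countable => // n _; case: (PG n).
  move=> x [n _ Anx]; have [_ /(_ _ Anx)[p Gp px] _] := PG n.
  by exists p => //; exists n.
apply: (@le_trans _ _ (\sum_(n <oo) \esum_(p in G n) box_vol p)); last first.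
  by apply: lee_nneseries => n _ *; [exact: esum_ge0|case: (PG n)].
rewrite seqDU_bigcup_eq nneseries_sum_bigcup; last 2 first.
- exact: trivIset_seqDU.
- exact: box_vol_ge0.
apply: lee_nneseries => n _ *; first exact: esum_ge0.
rewrite esum_mkcond [leRHS]esum_mkcond; apply: le_esum => p _.
case: ifPn => [/set_mem pD|_]; last by case: ifP.
by rewrite ifT//; apply/mem_set; exact: (@subset_seqDU _ G n p pD).
Qed.

HB.instance Definition _ := isOuterMeasure.Build R 'rV[R]_N (@vol R N)
  vol0 vol_ge0 le_vol vol_sigma_subadditive.

End vol_outer_measure.

Definition orthogonal_mx (R : realType) (N : nat) : set 'M[R]_N :=
  [set U | U *m U^T = 1%:M].

Definition cube (R : realType) (N : nat) (r : R) : set 'rV[R]_N :=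
  [set x | forall i, (`|x ord0 i| <= r)%R].

(* [V]_N: the infimum is attained, by compactness, whenever it is finite.
   Allowing U to be a reflection changes nothing, as reflections in the
   coordinates preserve the cube. *)
Definition cube_radius (R : realType) (N : nat) (V : set 'rV[R]_N) : \bar R :=
  ereal_inf [set r%:E | r in [set r : R | (0 <= r)%R /\
    exists (U : 'M[R]_N) (v : 'rV[R]_N), orthogonal_mx U /\
      V `<=` [set (x *m U + v)%R | x in cube r]]].

Definition borel_mx (R : realType) (N : nat) :=
  g_sigma_algebraType (@open 'M[R]_N).

(* theta is the Haar probability measure of the compact group O(N), which is
   the only one with these properties. *)
Definition haar_orthogonal (R : realType) (N : nat)
    (theta : probability (borel_mx R N) R) : Prop :=
  theta (@orthogonal_mx R N) = 1 /\
  forall (U : 'M[R]_N) (A : set (borel_mx R N)),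
    orthogonal_mx U -> measurable A ->
    theta [set U *m X | X in (A : set 'M[R]_N)] = theta A /\
    theta [set X *m U | X in (A : set 'M[R]_N)] = theta A.

Definition lebesgue_rV (R : realType) (m : nat) := caratheodory_type (@vol R m).

(* If u_j are the columns of an orthogonal matrix g and m <= N, this is the
   affine plane of codimension m with equations <x, u_j> = b_j for j < m; for
   m = 0 it is the whole space. *)
Definition plane (R : realType) (N m : nat)
    (gb : borel_mx R N * lebesgue_rV R m) : set 'rV[R]_N :=
  [set x | forall (i : 'I_N) (j : 'I_m), i = j :> nat ->
    (x *m (gb.1 : 'M[R]_N)) ord0 i = (gb.2 : 'rV[R]_m) ord0 j].

(* The affine planes of codimension m in R^N, with the final sigma-algebra for
   the parametrization by a frame and an offset. The carrier is the type of all
   sets of points, but the measure below only sees the sets that are planes. *)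
Definition affine_grassmannian (R : realType) (N m : nat) :=
  g_sigma_algebraType
    (image_set_system setT (@plane R N m) (@measurable _ _)).

(* The uniform measure: the direction of the plane is uniformly distributed,
   and its offset in the orthogonal complement follows the m-dimensional
   Lebesgue measure. Up to a factor, this is the only locally finite measure on
   the affine Grassmannian invariant under rigid motions. *)
Definition grassmannian_measure (R : realType) (N : nat)
    (theta : probability (borel_mx R N) R) (m : nat) :
    set (affine_grassmannian R N m) -> \bar R :=
  pushforward (theta \x (@vol R m : set (lebesgue_rV R m) -> \bar R))
    (@plane R N m : _ -> affine_grassmannian R N m).
Arguments grassmannian_measure {R N} theta m.

Definition path_joined (R : realType) (N : nat) (A : set 'rV[R]_N)
    (x y : 'rV[R]_N) : Prop :=
  exists f : R -> 'rV[R]_N, [/\ {within `[0%R, 1%R], continuous f},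
    f 0%R = x, f 1%R = y & f @` `[0%R, 1%R] `<=` A].

Definition path_components (R : realType) (N : nat) (A : set 'rV[R]_N) :
    set (set 'rV[R]_N) :=
  [set [set y | path_joined A x y] | x in A].

Definition regular_set (R : realType) (N : nat)
    (theta : probability (borel_mx R N) R) (K n : nat) (V : set 'rV[R]_N) :
    Prop :=
  (forall m : nat, (m <= N)%N -> (m <= n)%N ->
    {ae grassmannian_measure theta m, forall L : affine_grassmannian R N m,
      (path_components (V `&` (L : set 'rV[R]_N)) #<= `I_K)%card}) /\
  (forall m : nat, (m <= N)%N -> (n.+1 <= m)%N ->
    {ae grassmannian_measure theta m, forall L : affine_grassmannian R N m,
      V `&` (L : set 'rV[R]_N) = set0}).

(* Main.v *)
Require Import Defs.
From HB Require Import structures.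
From mathcomp Require Import all_boot all_order all_algebra fingroup perm.
From mathcomp Require Import all_classical all_reals all_analysis.
From mathcomp Require Import measurable_realfun ring lra.

Set Implicit Arguments.
Unset Strict Implicit.
Unset Printing Implicit Defensive.

Import Order.TTheory GRing.Theory Num.Theory.
Import numFieldNormedType.Exports.

Local Open Scope classical_set_scope.
Local Open Scope ring_scope.
Local Open Scope ereal_scope.

(** The tube estimate is soft: if finitely many balls of radius [eps] centred
    in [V] cover [V], the balls of radius [2 * eps] with the same centres cover
    the tube, and [vol] is subadditive, translation invariant and homogeneous of
    degree [N] ([vol_tube_le]). If no finite family exists, the right-hand side
    is infinite because the unit ball has positive volume.

    The bound on the covering number comes from counting the cells of a generic
    grid that meet [V]. Let [V] lie in a cube of half-side about [t] with axes
    given by an orthogonal frame, and cut space by the hyperplanes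
    [a_i = b_i + k * h], where the [a_i] are orthonormal coordinates and
    [h = eps / sqrt N], so that a cell has diameter [eps]. Choosing a point of
    [V] in every cell that meets [V] gives an [eps]-cover, so it is enough to
    bound the number of these cells.

    - Start from a point of [V] in a closed cell. As long as the path component
      of the current point in the slice of [V] by the grid plane reached so far
      leaves the cell, follow a path up to the moment it meets a new facet; the
      intermediate value theorem applied to one maximum of coordinate functions
      finds that moment ([face_descent_step]). This ends with a grid plane and a
      path component of its slice that stays inside the cell in all the
      coordinates that the plane leaves free ([face_descent]).
    - The plane, with the side of the cell on which each of its hyperplanes lies,
      and the component determine the cell. If every grid plane of codimension
      at most [n] cuts [V] in at most [K] components, and the others miss [V],
      there are at most [(2 * N * M + 1) ^ n * K] cells ([card_hit_cells]), where
      [M] is the number of layers of cells in each direction. Since [M] is of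
      the order of [t * sqrt N / eps], this is [K * (c * t * N^(3/2) / eps) ^ n].
    - Regularity only speaks of almost every plane. By Fubini, for almost every
      orthogonal frame the planes normal to its leading vectors are good for almost
      every offset ([ae_grassmannian_frames]); invariance under permutation
      matrices gives this for all subsets of the frame vectors at once
      ([generic_frame]). Every nonempty
      open set of frames has positive Haar measure
      ([near_frame_not_negligible]), so the frame can moreover be chosen so
      close to the axes of the cube containing [V] that [V] still lies in a
      cube of half-side [3 * t] along it: this, and not a bounding ball, is what
      keeps the exponent of [N] at [3/2]. Finally all the grid planes have
      offsets read off a single vector [b], and the bad vectors form a countable
      union of cylinders over null sets ([generic_offset]).

    The underlying measure theory is that of the outer measure [vol]: half-spaces
    are Caratheodory measurable, [vol] is sigma-finite, and a box is not covered
    by boxes of smaller total volume ([box_cover_le]). *)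

(** * The outer measure [vol] on boxes and countable covers *)

Section box_volume.
Context (R : realType) (N : nat).
Implicit Types (p : 'rV[R]_N * 'rV[R]_N) (A : set 'rV[R]_N).

Lemma box_vol_ge0 p : 0 <= box_vol p.
Proof. by rewrite lee_fin prodr_ge0// => i _; rewrite le_max lexx. Qed.

Lemma vol_box_le p : vol (box p) <= box_vol p.
Proof.
apply: ereal_inf_lbound; exists [set p].
  by split; [exact: countable1|rewrite bigcup_set1].
by rewrite esum_set1// box_vol_ge0.
Qed.

End box_volume.

(** Turns unordered sums over countable index sets into series, for which
    sigma-subadditivity and monotone convergence are available. *)
Lemma countable_enum (T : pointedType) (C : set T) : countable C ->
  exists (D : set nat) (g : nat -> T), set_bij D C g.
Proof.
move=> /countable_bijP[D CD]; exists D.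
by move: CD; rewrite card_eq_sym => /card_set_bijP[g gbij]; exists g.
Qed.

Lemma vol_countable_cover (R : realType) (N : nat) (T : pointedType) (C : set T)
    (A : set 'rV[R]_N) (F : T -> set 'rV[R]_N) : countable C ->
  A `<=` \bigcup_(p in C) F p -> vol A <= \esum_(p in C) vol (F p).
Proof.
move=> /countable_enum[D [g gDC]] AF.
have v0 (B : set 'rV[R]_N) : 0 <= vol B by exact: outer_measure_ge0.
rewrite (reindex_esum D C g)//.
apply: (@le_trans _ _ (vol (\bigcup_n (if n \in D then F (g n) else set0)))).
  apply: le_outer_measure => x /AF[p Cp Fx].
  have [_ _ /(_ _ Cp)[n Dn gn]] := gDC.
  by exists n => //; rewrite mem_set// gn.
apply: le_trans (outer_measure_sigma_subadditive _ _) _.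
rewrite nneseries_esumT// esum_mkcond.
rewrite [leRHS]esum_mkcond.
apply: le_esum => n _; rewrite mem_setT.
by case: ifPn => // _; rewrite outer_measure0.
Qed.

(** * Homotheties, half-spaces and sigma-finiteness *)

Lemma countable_esumZl (R : realType) (T : pointedType) (C : set T) (c : R)
    (f : T -> \bar R) : countable C -> (0 <= c)%R -> (forall p, 0 <= f p) ->
  \esum_(p in C) (c%:E * f p) = c%:E * \esum_(p in C) f p.
Proof.
move=> /countable_enum[D [g gDC]] c0 f0.
rewrite !(reindex_esum D C g)// -(set_mem_set D).
rewrite -!nneseries_esum//; last by move=> n _; rewrite mule_ge0// lee_fin.
by rewrite nneseriesZl.
Qed.

Section box_geometry.
Context (R : realType) (N : nat).
Implicit Types (p : 'rV[R]_N * 'rV[R]_N) (A : set 'rV[R]_N).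

Lemma box_vol_homothety p (y : 'rV[R]_N) (r : R) : (0 < r)%R ->
  box_vol (y + r *: p.1, y + r *: p.2)%R = (r ^+ N)%:E * box_vol p.
Proof.
move=> r0; rewrite /box_vol -EFinM.
have -> : (r ^+ N = \prod_(i < N) r)%R by rewrite prodr_const card_ord.
rewrite -big_split/=.
congr EFin; apply: eq_bigr => i _; rewrite !mxE maxr_pMr ?(ltW r0)// mulr0.
by congr Num.max; ring.
Qed.

Lemma vol_homothety_le A (y : 'rV[R]_N) (r : R) : (0 < r)%R ->
  vol [set (y + r *: x)%R | x in A] <= (r ^+ N)%:E * vol A.
Proof.
move=> r0; have rN0 : (0 < r ^+ N)%R by rewrite exprn_gt0.
rewrite -lee_pdivrMl//; apply: le_ereal_inf_tmp => _ [C [cC AC] <-].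
rewrite lee_pdivrMl// -countable_esumZl//; [|exact: ltW|exact: box_vol_ge0].
pose F p := [set (y + r *: x)%R | x in box p].
apply: le_trans (vol_countable_cover (F := F) cC _) _.
  by move=> _ [x Ax <-]; have [p Cp px] := AC _ Ax; exists p => //; exists x.
apply: le_esum => p _; rewrite -(box_vol_homothety _ y)//.
apply: le_trans (vol_box_le _); apply: le_outer_measure => _ [x px <-] i /=.
by rewrite !mxE !lerD2l !ler_pM2l.
Qed.

(** The truncation at [0] in [box_vol] makes this hold wherever the cutting
    hyperplane lies, including for empty boxes. *)
Lemma box_vol_cut p (i : 'I_N) (a : R) :
  box_vol (p.1, \row_j if j == i then Num.min a (p.2 ord0 j) else p.2 ord0 j)%R
  + box_vol (\row_j if j == i then Num.max a (p.1 ord0 j) else p.1 ord0 j, p.2)%R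
  = box_vol p.
Proof.
rewrite /box_vol -EFinD (bigD1 i)//= [in X in (_ + X)%R](bigD1 i)//=.
rewrite [in RHS](bigD1 i)//= !mxE eqxx.
under eq_bigr => j /negbTE ji do rewrite mxE ji.
under [in X in (_ + X)%R]eq_bigr => j /negbTE ji do rewrite mxE ji.
rewrite -mulrDl; congr (_ * _)%:E.
move: (p.1 ord0 i) (p.2 ord0 i) => l u.
rewrite /Num.max /Num.min.
by case: (ltP a u) => ?; case: (ltP a l) => ?; do ![case: ltP => ?]; lra.
Qed.

(** Each box of a cover is cut by the hyperplane into two boxes whose volumes
    add up, so a cover of [X] splits into covers of both parts. *)
Lemma halfspace_caratheodory (i : 'I_N) (a : R) :
  caratheodory_measurable (@vol R N) [set x : 'rV[R]_N | x ord0 i <= a]%R.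
Proof.
apply: le_caratheodory_measurable => /= X; apply: le_ereal_inf_tmp.
move=> _ [C [cC XC] <-].
pose lower p := (p.1, \row_j if j == i then Num.min a (p.2 ord0 j)
  else p.2 ord0 j)%R : 'rV[R]_N * 'rV[R]_N.
pose upper p := (\row_j if j == i then Num.max a (p.1 ord0 j)
  else p.1 ord0 j, p.2)%R : 'rV[R]_N * 'rV[R]_N.
have low : vol (X `&` [set x : 'rV[R]_N | x ord0 i <= a]%R) <=
    \esum_(p in C) box_vol (lower p).
  apply: le_trans (vol_countable_cover (F := fun p => box (lower p)) cC _) _.
    move=> x [/XC[p Cp px] /= xa]; exists p => // j /=.
    have /andP[pl pu] := px j; rewrite pl /= mxE; case: eqP => // ->.
    by rewrite le_min xa; case/andP: (px i).
  by apply: le_esum => p _; exact: vol_box_le.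
have up : vol (X `&` ~` [set x : 'rV[R]_N | x ord0 i <= a]%R) <=
    \esum_(p in C) box_vol (upper p).
  apply: le_trans (vol_countable_cover (F := fun p => box (upper p)) cC _) _.
    move=> x [/XC[p Cp px] /= /negP]; rewrite -ltNge => xa; exists p => // j /=.
    have /andP[pl pu] := px j; rewrite pu andbT /= mxE; case: eqP => // ->.
    by rewrite ge_max (ltW xa); case/andP: (px i).
  by apply: le_esum => p _; exact: vol_box_le.
apply: le_trans (leeD low up) _.
rewrite -esumD; try by move=> p _; exact: box_vol_ge0.
by apply: le_esum => p _; rewrite box_vol_cut.
Qed.

Lemma vol_box_lty p : vol (box p) < +oo.
Proof. by rewrite (le_lt_trans (vol_box_le p))// /box_vol ltry. Qed.

Lemma vol_sigma_finite :
  sigma_finite setT (@vol R N : set (lebesgue_rV R N) -> \bar R).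
Proof.
pose F (k : nat) := \bigcap_(i in [set: 'I_N]) ([set x : lebesgue_rV R N |
  (x : 'rV[R]_N) ord0 i <= k%:R]%R `&`
  ~` [set x : lebesgue_rV R N | (x : 'rV[R]_N) ord0 i <= - k%:R]%R).
exists F.
  apply/esym; rewrite -subTset => x _.
  exists (Num.truncn (\sum_(i < N) `|(x : 'rV[R]_N) ord0 i|)%R).+1 => // i _.
  have : (`|(x : 'rV[R]_N) ord0 i| <
      (Num.truncn (\sum_(i < N) `|(x : 'rV[R]_N) ord0 i|)).+1%:R)%R.
    apply: le_lt_trans (truncnS_gt _).
    by rewrite (bigD1 i)//= lerDl sumr_ge0.
  rewrite ltr_norml => /andP[h1 h2]; split => /=; first exact: ltW.
  by apply/negP; rewrite -ltNge.
move=> k; split.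
  apply: fin_bigcap_measurable; first exact: finite_finset.
  by move=> i _; apply: measurableI; last apply: measurableC;
    exact: halfspace_caratheodory.
apply: le_lt_trans (vol_box_lty (\row__ - k%:R, \row__ k%:R)%R).
apply: le_outer_measure => x Fx i /=; rewrite !mxE.
by have [/= -> /negP] := Fx i I; rewrite -ltNge => /ltW ->.
Qed.

End box_geometry.

(** * A box is not covered by boxes of smaller total volume *)

Lemma box_vol_recl (R : realType) (N : nat) (p : 'rV[R]_N.+1 * 'rV[R]_N.+1) :
  box_vol p = (Num.max 0 (p.2 ord0 ord0 - p.1 ord0 ord0))%:E *
    box_vol (col' ord0 p.1, col' ord0 p.2).
Proof.
rewrite /box_vol -EFinM big_ord_recl; congr (_ * _)%:E.
by apply: eq_bigr => i _; rewrite !mxE.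
Qed.

(** Induction on the dimension. For each value [x] of the first coordinate in the
    side of [q], the boxes whose first side contains [x] cover the slice of [q],
    so by induction their slices have enough volume; integrating this over [x]
    by monotone convergence gives the result, without any compactness. *)
Lemma box_cover_le (R : realType) (N : nat) (D : set nat)
    (p : nat -> 'rV[R]_N * 'rV[R]_N) (q : 'rV[R]_N * 'rV[R]_N) :
  (forall i, q.1 ord0 i <= q.2 ord0 i)%R ->
  box q `<=` \bigcup_(n in D) box (p n) ->
  box_vol q <= \esum_(n in D) box_vol (p n).
Proof.
elim: N D p q => [|N IHN] D p q q12 qD.
  have [|n Dn _] := qD 0%R; first by case.
  apply: esum_ge; exists [set n]; first by split=> // _ ->.
  by rewrite fsbig_set1 /box_vol !big_ord0.
pose t (b : 'rV[R]_N.+1 * 'rV[R]_N.+1) := (col' ord0 b.1, col' ord0 b.2).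
pose J (b : 'rV[R]_N.+1 * 'rV[R]_N.+1) :=
  `[b.1 ord0 ord0, b.2 ord0 ord0]%classic : set (measurableTypeR R).
pose f n (x : measurableTypeR R) : \bar R :=
  if n \in D then box_vol (t (p n)) * (\1_(J (p n)) x)%:E else 0.
have mJ b : measurable (J b) by exact: measurable_itv.
have f0 n (x : measurableTypeR R) : 0 <= f n x.
  by rewrite /f; case: ifP => // _; rewrite mule_ge0 ?box_vol_ge0 ?lee_fin.
have mf n : measurable_fun (J q) (f n).
  rewrite /f; case: (n \in D) => //.
  by apply: measurable_funeM; apply/measurable_EFinP; exact: measurable_indic.
have slice x : J q x -> box_vol (t q) <= \sum_(n <oo) f n x.
  move=> qx; rewrite nneseries_esumT//.
  have -> : \esum_(n in [set: nat]) f n x =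
      \esum_(n in D `&` [set n | J (p n) x]) box_vol (t (p n)).
    rewrite [RHS]esum_mkcond; apply: eq_esum => n _.
    rewrite /f in_setI indicE; case: ifPn => //= nD.
    rewrite -[X in if X then _ else _]/(n \in [set n | J (p n) x]).
    have -> : (n \in [set n | J (p n) x]) = (x \in J (p n)).
      by apply/idP/idP => /set_mem h; apply/mem_set.
    by case: ifP => _; rewrite ?mule1 ?mule0.
  apply: IHN => [i|y ty]; first by rewrite !mxE.
  pose z := (\row_j if unlift ord0 j is Some k then y ord0 k else x)%R :
    'rV[R]_N.+1.
  have [|n Dn pz] := qD z.
    move=> i; rewrite mxE; case: unliftP => [k ->|->].
      by have := ty k; rewrite !mxE.
    by move: qx; rewrite /J /= in_itv.
  exists n.
    split=> //; have := pz ord0; rewrite mxE unlift_none.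
    by rewrite /J /= in_itv.
  by move=> k; have := pz (lift ord0 k); rewrite !mxE liftK.
have lenJ b : lebesgue_measure (J b) =
    (Num.max 0 (b.2 ord0 ord0 - b.1 ord0 ord0)%R)%:E.
  rewrite /J lebesgue_measure_itv /= lte_fin /Num.max subr_gt0.
  by case: (b.1 ord0 ord0 < b.2 ord0 ord0)%R; rewrite ?EFinB.
rewrite box_vol_recl -lenJ.
rewrite muleC -integral_cst//.
apply: (@le_trans _ _ (\int[lebesgue_measure]_(x in J q) (\sum_(n <oo) f n x))).
  apply: ge0_le_integral => //.
  - by move=> x _; exact: box_vol_ge0.
  - by apply: ge0_emeasurable_sum => // n x _ _; exact: f0.
rewrite integral_nneseries// nneseries_esumT; last first.
  by move=> n; exact: integral_ge0.
rewrite [leRHS]esum_mkcond; apply: le_esum => n _.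
rewrite /f; case: (n \in D); last by rewrite integral0.
rewrite ge0_integralZl//; last 2 first.
- by apply/measurable_EFinP; exact: measurable_indic.
- exact: box_vol_ge0.
rewrite integral_indic// box_vol_recl muleC -lenJ lee_wpmul2r ?box_vol_ge0//.
by apply: le_measure; rewrite ?inE//; exact: measurableI.
Qed.

Lemma box_vol_le_vol (R : realType) (N : nat) (q : 'rV[R]_N * 'rV[R]_N)
    (A : set 'rV[R]_N) : (forall i, q.1 ord0 i <= q.2 ord0 i)%R ->
  box q `<=` A -> box_vol q <= vol A.
Proof.
move=> q12 qA; apply: le_ereal_inf_tmp => _ [C [/countable_enum[D [g gDC]] AC] <-].
rewrite (reindex_esum D C g)//; apply: box_cover_le => // x /qA /AC[p Cp px].
by have [_ _ /(_ _ Cp)[n Dn gn]] := gDC; exists n => //; rewrite gn.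
Qed.

(** * Cylinders over null sets *)

Section cylinders.
Context (R : realType) (m N : nat) (s : 'I_m -> 'I_N) (u : 'rV[R]_m).
Hypothesis s_inj : injective s.

(** A cover of [Z] by boxes becomes a cover of the part of the cylinder in [q] by
    giving each box the sides of [q] in the remaining directions; this
    multiplies the volumes by a constant. *)
Lemma vol_cylinder_le (q : 'rV[R]_N * 'rV[R]_N) : exists2 M : R, (0 < M)%R &
  forall Z : set 'rV[R]_m, vol (box q `&`
    [set b : 'rV[R]_N | Z ((\row_j b ord0 (s j)) + u)%R]) <= M%:E * vol Z.
Proof.
pose S := [set s j | j in [set: 'I_m]]%SET.
pose M : R := (\prod_(i | i \notin S) Num.max 0 (q.2 ord0 i - q.1 ord0 i))%R.
have M0 : (0 <= M)%R by apply: prodr_ge0 => i _; rewrite le_max lexx.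
(* M vanishes when a side of q is degenerate, hence the added 1. *)
exists (M + 1)%R => [|Z]; first by rewrite ltr_wpDl.
rewrite -lee_pdivrMl ?ltr_wpDl//; apply: le_ereal_inf_tmp => _ [C [cC ZC] <-].
rewrite lee_pdivrMl ?ltr_wpDl//.
pose ext (v : 'rV[R]_m) (w : 'rV[R]_N) := (\row_i
  if [pick j | s j == i] is Some j then v ord0 j - u ord0 j else w ord0 i)%R.
have extS v w j : ext v w ord0 (s j) = (v ord0 j - u ord0 j)%R.
  rewrite mxE; case: pickP => [k /eqP/s_inj -> //|/(_ j)].
  by rewrite eqxx.
have extN v w i : i \notin S -> ext v w ord0 i = w ord0 i.
  rewrite mxE; case: pickP => // k /eqP <- /negP[].
  by apply/imsetP; exists k; rewrite ?inE.
pose cyl p := (ext p.1 q.1, ext p.2 q.2).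
have cylE p : box_vol (cyl p) = M%:E * box_vol p.
  rewrite /box_vol -EFinM (bigID (mem S))/= mulrC; congr (_ * _)%:E.
    by apply: eq_bigr => i iS; rewrite !extN.
  rewrite (eq_bigl (mem S))// big_imset/=; last by move=> ? ? _ _ /s_inj.
  rewrite (eq_bigl xpredT); last by move=> j; rewrite inE.
  by apply: eq_bigr => j _; rewrite !extS; congr Num.max; ring.
rewrite -countable_esumZl//; last 2 first.
- by rewrite addr_ge0.
- exact: box_vol_ge0.
apply: le_trans (vol_countable_cover (F := fun p => box (cyl p)) cC _) _.
  move=> b [qb /ZC[p Cp pb]]; exists p => // i /=.
  have [/imsetP[j _ ->]|iS] := boolP (i \in S).
    by rewrite !extS; have := pb j; rewrite !mxE lerBlDr lerBrDr.
  by rewrite !extN//; exact: qb.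
apply: le_esum => p _; apply: le_trans (vol_box_le _) _.
by rewrite cylE lee_wpmul2r ?box_vol_ge0// lee_fin lerDl.
Qed.

Lemma vol_cylinder0 (q : 'rV[R]_N * 'rV[R]_N) (Z : set 'rV[R]_m) :
  vol Z = 0 ->
  vol (box q `&` [set b : 'rV[R]_N | Z ((\row_j b ord0 (s j)) + u)%R]) = 0.
Proof.
move=> Z0; apply/eqP; rewrite eq_le outer_measure_ge0 andbT.
by have [M _ /(_ Z)] := vol_cylinder_le q; rewrite Z0 mule0.
Qed.

End cylinders.

(** * Euclidean balls and tubes *)

Section euclidean_norm.
Context (R : realType) (N : nat).
Implicit Types (x y : 'rV[R]_N) (c r : R).

Lemma enorm_ge0 x : (0 <= enorm x)%R.
Proof. exact: sqrtr_ge0. Qed.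

Lemma enorm_sqr x : (enorm x ^+ 2 = \sum_(i < N) x ord0 i ^+ 2)%R.
Proof. by rewrite sqr_sqrtr// sumr_ge0// => i _; rewrite sqr_ge0. Qed.

Lemma enorm_le x r : (0 <= r)%R ->
  (enorm x <= r)%R = (\sum_(i < N) x ord0 i ^+ 2 <= r ^+ 2)%R.
Proof. by move=> r0; rewrite -enorm_sqr ler_pXn2r// nnegrE enorm_ge0. Qed.

Lemma enormZ c x : (0 <= c)%R -> enorm (c *: x)%R = (c * enorm x)%R.
Proof.
move=> c0; apply/eqP; rewrite -(@eqrXn2 _ 2)// ?mulr_ge0 ?enorm_ge0//.
rewrite exprMn !enorm_sqr mulr_sumr; apply/eqP; apply: eq_bigr => i _.
by rewrite mxE exprMn.
Qed.

Lemma enormN x : enorm (- x)%R = enorm x.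
Proof.
by congr Num.sqrt; apply: eq_bigr => i _; rewrite mxE sqrrN.
Qed.

Lemma enorm_eq0 x : enorm x = 0%R -> x = 0%R.
Proof.
move=> x0; have /eqP := enorm_sqr x; rewrite x0 expr0n/= eq_sym.
rewrite psumr_eq0 => [/allP xi|i _]; last exact: sqr_ge0.
apply/rowP => i; apply/eqP; rewrite mxE -sqrf_eq0.
by apply: xi; rewrite mem_index_enum.
Qed.

Lemma cauchy_schwarz x y :
  (\sum_(i < N) x ord0 i * y ord0 i <= enorm x * enorm y)%R.
Proof.
have [x0|x0] := eqVneq (enorm x) 0%R.
  rewrite x0 mul0r (enorm_eq0 x0) big1// => i _.
  by rewrite mxE mul0r.
have [y0|y0] := eqVneq (enorm y) 0%R.
  rewrite y0 mulr0 (enorm_eq0 y0) big1// => i _.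
  by rewrite mxE mulr0.
have xy0 : (0 < enorm x * enorm y)%R by rewrite mulr_gt0// lt0r enorm_ge0 ?x0 ?y0.
have : (0 <= \sum_(i < N) (enorm y * x ord0 i - enorm x * y ord0 i) ^+ 2)%R.
  by apply: sumr_ge0 => i _; exact: sqr_ge0.
rewrite (eq_bigr (fun i => enorm y ^+ 2 * x ord0 i ^+ 2 +
  enorm x ^+ 2 * y ord0 i ^+ 2 -
  2 * (enorm x * enorm y) * (x ord0 i * y ord0 i))%R); last by move=> i _; ring.
rewrite sumrB big_split/= -!mulr_sumr -!enorm_sqr => h.
rewrite -(ler_pM2l xy0); lra.
Qed.

Lemma enorm_triangle x y : (enorm (x + y) <= enorm x + enorm y)%R.
Proof.
rewrite enorm_le ?addr_ge0 ?enorm_ge0//.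
rewrite (eq_bigr (fun i => x ord0 i ^+ 2 + y ord0 i ^+ 2 +
  2 * (x ord0 i * y ord0 i))%R); last by move=> i _; rewrite mxE; ring.
rewrite 2!big_split/= -!mulr_sumr -!enorm_sqr.
by have := cauchy_schwarz x y; lra.
Qed.

Lemma vol_eball_le y r : (0 < r)%R ->
  vol (eball y r) <= (r ^+ N)%:E * vol (eball (0 : 'rV[R]_N)%R 1).
Proof.
move=> r0; apply: le_trans (vol_homothety_le _ y r0).
apply: le_outer_measure => z yz; exists (r^-1 *: (z - y))%R.
  rewrite /eball /= sub0r enormN enormZ ?invr_ge0 ?(ltW r0)//.
  by rewrite mulrC ler_pdivrMr// mul1r -enormN opprB.
by rewrite scalerA mulfV ?gt_eqF// scale1r subrKC.
Qed.

(** The ball contains a cube of side [1 / (N + 1)], a side that also makes sense in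
    dimension [0]. *)
Lemma vol_unit_eball_gt0 : 0 < vol (eball (0 : 'rV[R]_N)%R 1).
Proof.
pose d : R := (N.+1%:R^-1)%R; have d0 : (0 < d)%R by rewrite invr_gt0.
apply: (@lt_le_trans _ _ (box_vol (0, const_mx d : 'rV[R]_N)%R)).
  rewrite lte_fin prodr_gt0// => i _.
  by rewrite !mxE subr0 lt_max d0 orbT.
apply: box_vol_le_vol => [i|x xd /=]; first by rewrite !mxE ltW.
rewrite /eball /= sub0r enormN enorm_le// expr1n.
apply: (@le_trans _ _ (\sum_(i < N) d))%R.
  apply: ler_sum => i _; have := xd i; rewrite !mxE => /andP[x0 x1].
  rewrite expr2 -[leRHS]mulr1 ler_pM//; apply: le_trans x1 _.
  by rewrite invf_le1// ler1n.
rewrite sumr_const card_ord -[leLHS]mulr_natr mulrC.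
by rewrite ler_pdivrMr// mul1r ler_nat.
Qed.

Lemma vol_unit_eball_lty : vol (eball (0 : 'rV[R]_N)%R 1) < +oo.
Proof.
apply: le_lt_trans (vol_box_lty (const_mx (-1), const_mx 1 : 'rV[R]_N)%R).
apply: le_outer_measure => x; rewrite /eball /= sub0r enormN => x1 i /=.
rewrite !mxE -ler_norml -(@ler_pXn2r _ 2)// ?nnegrE// expr1n real_normK ?num_real//.
move: x1; rewrite enorm_le// expr1n; apply: le_trans.
by rewrite (bigD1 i)//= lerDl sumr_ge0// => j _; exact: sqr_ge0.
Qed.

(** Dividing by the volume of a ball, which is positive and finite, reduces the
    claim to a lower bound of an infimum, so the case of an infinite covering
    number needs no separate treatment. *)
Lemma vol_tube_le (V : set 'rV[R]_N) (eps : R) : (0 < eps)%R ->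
  vol (tube V eps) <= covering_number V eps * ((2 * eps) ^+ N)%R%:E *
    vol (eball (0 : 'rV[R]_N)%R 1).
Proof.
move=> e0; have e20 : (0 < 2 * eps)%R by rewrite mulr_gt0.
have := vol_unit_eball_lty; have := vol_unit_eball_gt0.
have : forall y, _ := fun y => vol_eball_le y e20.
case: (vol (eball 0%R 1)) => // v ball v0 _; rewrite -muleA -EFinM.
have c0 : (0 < (2 * eps) ^+ N * v)%R by rewrite mulr_gt0// exprn_gt0.
rewrite -lee_pdivrMr//; apply: le_ereal_inf_tmp.
move=> _ [k [S [SV Sk cov]] <-]; rewrite lee_pdivrMr//.
have cS : finite_set S by exists k.
apply: le_trans (vol_countable_cover (F := fun y => eball y (2 * eps)%R)
  (finite_set_countable cS) _) _.
  move=> z [x Vx xz]; have [y Sy xy] := cov _ Vx; exists y => //.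
  rewrite /eball /= -(subrKA x) (le_trans (enorm_triangle _ _))//.
  by rewrite -enormN opprB (le_trans (lerD xy xz))// mulrDl !mul1r.
apply: (@le_trans _ _ (\esum_(y in S) ((2 * eps) ^+ N * v)%:E)).
  by apply: le_esum => y _; rewrite EFinM; exact: ball.
move: Sk; rewrite card_eq_sym => /card_set_bijP[g gS].
rewrite (reindex_esum `I_k S g)// esum_fset//; last by move=> *; exact: ltW.
by rewrite -fsbig_ord sumEFin sumr_const card_ord -EFinM (mulr_natl _ k).
Qed.

End euclidean_norm.

(** * Descent to the faces of a cell *)

Lemma continuous_bigmax (R : realType) (T : topologicalType) (I : Type)
    (r : seq I) (P : pred I) (x0 : R) (f : I -> T -> R^o) :
  (forall i, continuous (f i)) ->
  continuous (fun x => \big[Num.max/x0]_(i <- r | P i) f i x : R^o).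
Proof.
move=> fc; elim: r => [|i r IHr] x.
  by under eq_fun do rewrite big_nil; exact: cst_continuous.
under eq_fun do rewrite big_cons; case: (P i) => //; last exact: IHr.
by apply: continuous_max; [exact: fc|exact: IHr].
Qed.

Lemma path_joined_refl (R : realType) (N : nat) (A : set 'rV[R]_N)
  (x : 'rV[R]_N) : A x -> path_joined A x x.
Proof.
move=> Ax; exists (cst x); split => //; last by move=> _ [s _ <-].
by apply: continuous_subspaceT => ?; exact: cst_continuous.
Qed.

Section descent.
Context (R : realType) (N : nat) (V : set 'rV[R]_N).
Context (a : 'I_N -> 'rV[R]_N -> R) (lvl : 'I_N -> bool -> R).
Hypothesis lvl_lt : forall i, (lvl i false < lvl i true)%R.
Hypothesis a_cont : forall i, continuous (a i : 'rV[R]_N -> R^o).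

(** [lvl i false] and [lvl i true] are the two ends of the cell in direction [i],
    and a list of pairs [(i, e)] selects an end in some of the directions. *)
Definition face (w : seq ('I_N * bool)) : set 'rV[R]_N :=
  [set x | forall p, p \in w -> a p.1 x = lvl p.1 p.2].

Definition cell (x : 'rV[R]_N) : Prop :=
  forall i, (lvl i false <= a i x <= lvl i true)%R.

(** Along a path that leaves the cell, the largest excess of a free coordinate
    over its bounds goes from nonpositive to nonnegative. Where it vanishes the
    path is still in the closed cell and touches a new facet. *)
Lemma face_descent_step (w : seq ('I_N * bool)) (x z : 'rV[R]_N) (i : 'I_N) :
  face w x -> cell x -> path_joined (V `&` face w) x z ->
  i \notin map fst w -> ~~ (lvl i false < a i z < lvl i true)%R ->
  exists j e y, [/\ j \notin map fst w, V y, face ((j, e) :: w) y & cell y].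
Proof.
move=> wx qx [g [gc g0 g1 gA]] iw iz.
(* The initial value -1 is never the maximum where psi is nonnegative. *)
pose psi y := \big[Num.max/(-1 : R^o)%R]_(j | j \notin map fst w)
  Num.max (lvl j false - a j y)%R (a j y - lvl j true)%R.
have psic : continuous (psi : 'rV[R]_N -> R^o).
  apply: continuous_bigmax => j y.
  apply: (@continuous_max R _ (fun y => lvl j false - a j y : R^o)%R
    (fun y => a j y - lvl j true : R^o)%R).
    by apply: continuousB; [exact: cst_continuous|exact: a_cont].
  by apply: continuousB; [exact: a_cont|exact: cst_continuous].
have [s s01 psis] : exists2 s, s \in `[0%R, 1%R] & psi (g s) = 0%R.
  apply: (@IVT R (psi \o g)) => //.
    move=> s; have gs := gc s; have psigs := psic (g s).
    exact: continuous_comp gs psigs.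
  rewrite /= g0 g1 ge_min le_max; apply/andP; split; apply/orP.
    left; apply/bigmax_leP; split; first by rewrite lerN10.
    by move=> j _; rewrite ge_max !subr_le0.
  right; apply/bigmax_geP; right; exists i => //.
  by move: iz; rewrite negb_and -!leNgt le_max !subr_ge0.
have [Vy wy] : (V `&` face w) (g s) by apply: gA; exists s.
have : (psi (g s) <= 0)%R by rewrite psis.
move/bigmax_leP => [_ inside].
have : (0 <= psi (g s))%R by rewrite psis.
move/bigmax_geP => [|[j jw]]; first by rewrite lerNr oppr0 ler10.
have := inside j jw; rewrite ge_max !subr_le0 le_max !subr_ge0 => jin jout.
exists j, (lvl j true <= a j (g s))%R, (g s); split=> //.
  move=> p; rewrite inE => /predU1P[->/=|/wy//].
  case: leP => h; apply/eqP; rewrite eq_le.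
    by rewrite h andbT; case/andP: jin.
  move: jout; rewrite [X in _ || X]leNgt h orbF => ->.
  by case/andP: jin.
move=> k; have [kw|kw] := boolP (k \in map fst w).
  move/mapP: kw => [[k' e] kew /= ->]; rewrite (wy _ kew) /=.
  by case: e {kew}; rewrite lexx ?andbT ?andTb ltW.
by have := inside k kw; rewrite ge_max !subr_le0.
Qed.

(** Each step adds a direction to the list, so there are at most [N] steps. *)
Lemma face_descent (w : seq ('I_N * bool)) (x : 'rV[R]_N) :
  uniq (map fst w) -> V x -> face w x -> cell x ->
  exists w' y, [/\ uniq (map fst w'), V y, face w' y, cell y &
    forall z, path_joined (V `&` face w') y z ->
    forall i, i \notin map fst w' -> (lvl i false < a i z < lvl i true)%R].
Proof.
have [k] := ubnP (N - size w); elim: k w x => // k IHk w x wk uw Vx wx qx.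
have [inside|] := pselect (forall z, path_joined (V `&` face w) x z ->
    forall i, i \notin map fst w -> (lvl i false < a i z < lvl i true)%R).
  by exists w, x.
move=> /existsNP[z /not_implyP[xz /existsNP[i /not_implyP[iw /negP iz]]]].
have [j [e [y [jw Vy wy qy]]]] := face_descent_step wx qx xz iw iz.
apply: (IHk ((j, e) :: w) y) => //=; last by rewrite jw.
have : (size (j :: map fst w) <= N)%N.
  rewrite -[leqRHS](card_ord N) -(card_uniqP _) ?max_card//=.
  by rewrite jw.
by rewrite /= size_map => wN; rewrite subnSK.
Qed.

End descent.

(** * Counting the cells of a grid that meet a set *)

Lemma card_le_label (T : Type) (A : set T) (K : nat) : (A #<= `I_K)%card ->
  exists f : T -> nat, (forall x, A x -> (f x < K)%N) /\
    forall x y, A x -> A y -> f x = f y -> x = y.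
Proof.
move=> /pcard_leP[f]; exists f; split=> [x Ax|x y Ax Ay].
  by have := @funS _ _ _ _ f x Ax.
by move=> /(inj (mem_set Ax) (mem_set Ay)).
Qed.

Section grid.
Context (R : realType) (N : nat) (V : set 'rV[R]_N).
Context (a : 'I_N -> 'rV[R]_N -> R) (b : 'I_N -> R) (h : R) (M K n : nat).
Hypothesis a_cont : forall i, continuous (a i : 'rV[R]_N -> R^o).
Hypothesis h_gt0 : (0 < h)%R.

Definition grid_lvl (i : 'I_N) (k : nat) : R := (b i + k%:R * h)%R.

Local Notation incidence := ('I_N * ('I_M * bool))%type.

(** A triple [(i, (k, e))] stands for the hyperplane that bounds the [k]-th layer
    in direction [i] from below or from above according to [e]. Recording the
    layer and the side rather than the index [k + e] of the hyperplane makes it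
    possible to read the position of the cell off the list. *)
Definition grid_plane (u : seq incidence) : set 'rV[R]_N :=
  [set x | forall p, p \in u -> a p.1 x = grid_lvl p.1 (p.2.1 + p.2.2)].

Definition grid_regular : Prop := forall u : seq incidence,
  uniq (map fst u) ->
  ((size u <= n)%N ->
    (path_components (V `&` grid_plane u) #<= `I_K)%card) /\
  ((n < size u)%N -> V `&` grid_plane u = set0).

Definition grid_cell (q : {ffun 'I_N -> 'I_M}) : set 'rV[R]_N :=
  [set x | forall i, (grid_lvl i (q i) <= a i x <= grid_lvl i (q i).+1)%R].

Definition hit_cells : {set {ffun 'I_N -> 'I_M}} :=
  [set q | `[< exists2 x, V x & grid_cell q x >]]%SET.

Lemma grid_lvl_lt (i : 'I_N) (k l : nat) (z : R) :
  (grid_lvl i k < z)%R -> (z < grid_lvl i l)%R -> (k < l)%N.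
Proof.
by move=> kz /(lt_trans kz); rewrite /grid_lvl ltrD2l ltr_pM2r// ltr_nat.
Qed.

Lemma hit_cell_witness (q : {ffun 'I_N -> 'I_M}) : grid_regular ->
  q \in hit_cells ->
  exists u y, [/\ uniq (map fst u), (size u <= n)%N,
    forall p, p \in u -> p.2.1 = q p.1, (V `&` grid_plane u) y &
    forall z, path_joined (V `&` grid_plane u) y z ->
      forall i, i \notin map fst u ->
      (grid_lvl i (q i) < a i z < grid_lvl i (q i).+1)%R].
Proof.
move=> reg; rewrite inE => /asboolP[x Vx qx].
pose lvl i (e : bool) := grid_lvl i (q i + e).
have lvl_lt i : (lvl i false < lvl i true)%R.
  by rewrite /lvl /grid_lvl ltrD2l ltr_pM2r// ltr_nat addn0 addn1.
have [||||w [y [uw Vy wy _ inside]]] :=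
    @face_descent R N V a lvl lvl_lt a_cont [::] x; do ?by [].
  by move=> i; rewrite /lvl addn0 addn1; exact: qx.
pose u := [seq (p.1, (q p.1, p.2)) | p <- w].
have uE : map fst u = map fst w by rewrite -map_comp.
have planeE : grid_plane u = face a lvl w.
  apply/seteqP; split=> z uz p.
    by move=> pw; apply: (uz (p.1, (q p.1, p.2))); apply/mapP; exists p.
  by move=> /mapP[p' pw ->]; exact: uz.
exists u, y; rewrite uE planeE; split => //.
- rewrite leqNgt; apply/negP => nu; have := (reg u _).2 nu.
  by rewrite uE planeE => /(_ uw); rewrite -subset0 => /(_ y); apply.
- by move=> p /mapP[p' _ ->].
- move=> z yz i iw; have := inside z yz i iw.
  by rewrite /lvl addn0 addn1.
Qed.

(** The code of a cell is the list of incidences given by the descent, padded to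
    length [n], with the label of the component reached. It determines the
    cell: the incidences contain its position in their own directions, and in
    the others the component lies strictly between two consecutive hyperplanes. *)
Lemma card_hit_cells : grid_regular ->
  (#|hit_cells| <= (N * (M * 2)).+1 ^ n * K)%N.
Proof.
move=> reg.
have /choice[lab labP] : forall u : seq incidence, exists f : set 'rV[R]_N -> nat,
    uniq (map fst u) -> (size u <= n)%N ->
    (forall C, path_components (V `&` grid_plane u) C -> (f C < K)%N) /\
    forall C C', path_components (V `&` grid_plane u) C ->
      path_components (V `&` grid_plane u) C' -> f C = f C' -> C = C'.
  move=> u; have [/andP[uu un]|un] := boolP (uniq (map fst u) && (size u <= n)%N).
    by have [f fP] := card_le_label ((reg u uu).1 un); exists f.
  by exists (fun=> 0%N) => uu su; rewrite uu su in un.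
pose code := (n.-tuple (option incidence) * 'I_K)%type.
pose Phi (q : {ffun 'I_N -> 'I_M}) (c : code) := let u := pmap id c.1 in
  exists y, [/\ uniq (map fst u), (size u <= n)%N,
    forall p, p \in u -> p.2.1 = q p.1, (V `&` grid_plane u) y /\
    c.2 = lab u [set z | path_joined (V `&` grid_plane u) y z] :> nat &
    forall z, path_joined (V `&` grid_plane u) y z ->
      forall i, i \notin map fst u ->
      (grid_lvl i (q i) < a i z < grid_lvl i (q i).+1)%R].
have PhiE q : q \in hit_cells -> exists c, Phi q c.
  move=> /(hit_cell_witness reg)[u [y [uu un uq Vy inside]]].
  have s_size : size (map some u ++ nseq (n - size u) None) == n.
    by rewrite size_cat size_map size_nseq subnKC.
  have [labK _] := labP u uu un.
  have yK : (lab u [set z | path_joined (V `&` grid_plane u) y z] < K)%N.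
    by apply: labK; exists y.
  exists (Tuple s_size, Ordinal yK); rewrite /Phi /=.
  have -> : pmap id (map some u ++ nseq (n - size u) None) = u.
    rewrite pmap_cat -[RHS]cats0; congr (_ ++ _).
      by elim: (u) => //= p u' ->.
    by elim: (n - size u)%N.
  by exists y.
have Phi_inj q q' c : Phi q c -> Phi q' c -> q = q'.
  move=> [y [uu un uq [Vy cy] inq]] [y' [_ _ uq' [Vy' cy'] inq']].
  apply/ffunP => i.
  have [/mapP[p pu ->]|iu] := boolP (i \in map fst (pmap id c.1)).
    by rewrite -uq// -uq'.
  have [_ labinj] := labP _ uu un.
  have yy' : path_joined (V `&` grid_plane (pmap id c.1)) y y'.
    suff -> : path_joined (V `&` grid_plane (pmap id c.1)) y =
        path_joined (V `&` grid_plane (pmap id c.1)) y'.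
      exact: path_joined_refl.
    by apply: labinj; [exists y|exists y'|rewrite -[LHS]cy -cy'].
  have /andP[l1 r1] := inq y' yy' i iu.
  have /andP[l2 r2] := inq' y' (path_joined_refl Vy') i iu.
  apply/val_inj/eqP; rewrite eqn_leq -ltnS (grid_lvl_lt l1 r2) /=.
  by rewrite -ltnS (grid_lvl_lt l2 r1).
have [->|[q0 /PhiE[c0 _]]] := set_0Vmem hit_cells; first by rewrite cards0.
have /choice[F FP] : forall q, exists c, q \in hit_cells -> Phi q c.
  move=> q; have [/PhiE[c qc]|qh] := boolP (q \in hit_cells); first by exists c.
  by exists c0.
have : (#|hit_cells| <= #|{: code}|)%N.
  apply: (@leq_card_in _ _ F) => q q' /FP qF /FP q'F FE.
  by apply: (Phi_inj _ _ (F q)) => //; rewrite FE.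
by rewrite card_prod card_tuple card_option !card_prod card_bool !card_ord.
Qed.

Lemma covering_number_le_hit_cells (eps : R) :
  (forall x i, V x -> 0 <= a i x - b i < M%:R * h)%R ->
  (forall x y, (forall i, `|a i x - a i y| <= h) -> enorm (x - y) <= eps)%R ->
  covering_number V eps <= (#|hit_cells|%:R : R)%:E.
Proof.
move=> rangeV near.
have /choice[pt ptP] : forall q, exists x, q \in hit_cells -> V x /\ grid_cell q x.
  move=> q; rewrite inE; case: asboolP => [[x Vx qx]|_]; first by exists x.
  by exists 0%R.
pose S := [set pt (enum_val i) | i in [set: 'I_#|hit_cells|]].
have SK : (S #<= `I_#|hit_cells|)%card.
  apply: card_le_trans (card_image_le _ _) _.
  by rewrite -(card_le_eql card_II) card_le_II.
have [k Sk] : finite_set S by apply/finite_set_leP; exists #|hit_cells|.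
have kh : (k <= #|hit_cells|)%N.
  by rewrite -card_le_II -(card_le_eql Sk).
apply: (@le_trans _ _ (k%:R : R)%:E); last by rewrite lee_fin ler_nat.
apply: ereal_inf_lbound; exists k => //; exists S; split => //.
  by move=> _ [i _ <-]; have [] := ptP _ (enum_valP i).
move=> x Vx.
have M_lt i : (Num.truncn ((a i x - b i) / h) < M)%N.
  have /andP[x0 xM] := rangeV x i Vx.
  by rewrite truncn_lt_nat ?divr_ge0// ?(ltW h_gt0)// ltr_pdivrMr.
pose q := [ffun i => Ordinal (M_lt i)].
have qx : grid_cell q x.
  move=> i; have /andP[x0 xM] := rangeV x i Vx; rewrite ffunE /= /grid_lvl.
  have /andP[t1 t2] := truncn_itv (divr_ge0 x0 (ltW h_gt0)).
  move: t1 t2; rewrite ler_pdivlMr// ltr_pdivrMr// => t1 t2.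
  by apply/andP; split; lra.
have qh : q \in hit_cells by rewrite inE; apply/asboolP; exists x.
exists (pt q).
  by exists (enum_rank_in qh q) => //; rewrite enum_rankK_in.
apply: near => i; have [_ /(_ i)/andP[p1 p2]] := ptP q qh.
have /andP[x1 x2] := qx i; rewrite ler_norml.
by move: p1 p2 x1 x2; rewrite /grid_lvl -natr1; lra.
Qed.

End grid.

(** * Null sets of planes and frames *)

(** Sigma-finiteness makes the measure of the sections a measurable function, so
    that a vanishing integral forces it to vanish almost everywhere. *)
Lemma null_caratheodory_product (d : measure_display) (T1 : measurableType d)
    (R : realType) (T : pointedType) (mu : {outer_measure set T -> \bar R})
    (P : {measure set T1 -> \bar R}) (E : set (T1 * caratheodory_type mu)) :
  sigma_finite setT (mu : set (caratheodory_type mu) -> \bar R) ->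
  measurable E -> (P \x (mu : set (caratheodory_type mu) -> \bar R)) E = 0 ->
  P.-negligible [set x | mu (xsection E x) <> 0].
Proof.
move=> mu_fin mE PE0.
pose m : {measure set (caratheodory_type mu) -> \bar R} := mu.
pose B := Measure_isSigmaFinite.Build _ _ _ (Measure.sort m) mu_fin.
pose m' := HB.pack_for (SigmaFiniteMeasure.type (caratheodory_type mu) R)
  (Measure.sort m) B.
have mf : measurable_fun setT (mu \o xsection E).
  exact: (@measurable_fun_xsection _ _ _ _ _ m' E mE).
have [|A [mA PA0 AE]] := (ae_eq_integral_abs P measurableT mf).1 _.
  rewrite -[RHS]PE0; apply: eq_integral => x _ /=.
  by rewrite gee0_abs// outer_measure_ge0.
exists A; split=> // x /= xE; apply: AE => /= /(_ I).
exact: xE.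
Qed.

(** The final sigma-algebra on the set of planes makes the exceptional set of
    planes pull back to a measurable null set of pairs of a frame and an offset. *)
Lemma ae_grassmannian_frames (R : realType) (N m : nat)
    (theta : probability (borel_mx R N) R) (P : set 'rV[R]_N -> Prop) :
  {ae grassmannian_measure theta m,
    forall L : affine_grassmannian R N m, P (L : set 'rV[R]_N)} ->
  theta.-negligible [set g | vol [set b : 'rV[R]_m |
    ~ P (plane ((g : borel_mx R N), (b : lebesgue_rV R m)))] <> 0].
Proof.
move=> [A [mA A0 PA]].
pose E := (@plane R N m) @^-1` A.
have mE : measurable E.
  have : image_set_system setT (@plane R N m) (@measurable _ _) A.
    apply: (@smallest_sub _ (sigma_algebra setT)
      (image_set_system setT (@plane R N m) (@measurable _ _))) mA => //.
    exact/sigma_algebra_image/sigma_algebra_measurable.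
  by rewrite /image_set_system /= setTI.
have := @null_caratheodory_product _ _ R 'rV[R]_m (@vol R m) theta E
  (@vol_sigma_finite R m) mE A0.
apply: negligibleS => g /= Pg; apply: contra_not Pg => Eg.
apply/eqP; rewrite eq_le outer_measure_ge0 andbT -Eg.
by apply: le_outer_measure => b /= Pb; apply/mem_set/PA.
Qed.

(** * Measurability in the space of matrices *)

Lemma continuous_bigsum (R : realType) (T : topologicalType) (I : Type)
    (r : seq I) (f : I -> T -> R^o) : (forall i, continuous (f i)) ->
  continuous (fun x => \sum_(i <- r) f i x : R^o)%R.
Proof.
move=> fc; elim: r => [|i r IHr] x.
  by under eq_fun do rewrite big_nil; exact: cst_continuous.
under eq_fun do rewrite big_cons.
by apply: continuousD; [exact: fc|exact: IHr].
Qed.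

Lemma continuous_mulmx_entry (R : realType) (m n p : nat) (T : topologicalType)
    (A : T -> 'M[R]_(m, n)) (B : T -> 'M[R]_(n, p)) :
  (forall i j, continuous (fun x => A x i j : R^o)) ->
  (forall i j, continuous (fun x => B x i j : R^o)) ->
  forall i j, continuous (fun x => (A x *m B x)%R i j : R^o).
Proof.
move=> Ac Bc i j; under eq_fun do rewrite mxE.
by apply: continuous_bigsum => k x; apply: continuousM; [exact: Ac|exact: Bc].
Qed.

Lemma entry_continuous (R : realType) (m n : nat) (i : 'I_m) (j : 'I_n) :
  continuous (fun X : 'M[R]_(m, n) => X i j : R^o).
Proof. exact: coord_continuous. Qed.

Lemma continuous_mx (R : realType) (m n : nat) (T : topologicalType)
    (f : T -> 'M[R]_(m, n)) :
  (forall i j, continuous (fun x => f x i j : R^o)) -> continuous f.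
Proof.
move=> fc x A [P Pn PA].
have : \forall y \near x, forall i j, P i j (f y i j).
  by do 2![apply: filter_forall => ?]; apply: fc; exact: Pn.
by apply: filterS => y yP; apply: PA.
Qed.

Section borel_matrices.
Context (R : realType) (N : nat).

Lemma borel_mx_open (A : set 'M[R]_N) : open A ->
  measurable (A : set (borel_mx R N)).
Proof. by move=> oA; apply: sub_sigma_algebra. Qed.

Lemma borel_mx_closed (A : set 'M[R]_N) : closed A ->
  measurable (A : set (borel_mx R N)).
Proof.
move=> cA; rewrite -(setCK A); apply: measurableC; apply: borel_mx_open.
exact: closed_openC.
Qed.

Lemma measurable_mulmx (P Q : 'M[R]_N) (A : set (borel_mx R N)) :
  measurable A ->
  measurable [set X : borel_mx R N | A (P *m (X : 'M[R]_N) *m Q)%R].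
Proof.
pose f (X : borel_mx R N) : borel_mx R N := (P *m (X : 'M[R]_N) *m Q)%R.
suff mf : measurable_fun setT f.
  by move=> mA; rewrite -[X in measurable X]setTI; exact: mf.
apply: (@measurability _ _ _ (borel_mx R N) _ f (@open 'M[R]_N)) => //.
move=> _ [B oB <-]; rewrite setTI; apply: borel_mx_open.
apply: (@open_comp _ _ (f : 'M[R]_N -> 'M[R]_N)) oB => X _.
apply: continuous_mx => i j; apply: continuous_mulmx_entry => k l.
  apply: continuous_mulmx_entry => ? ?; last exact: entry_continuous.
  by move=> ?; exact: cst_continuous.
by move=> ?; exact: cst_continuous.
Qed.

Lemma measurable_orthogonal_mx :
  measurable (@orthogonal_mx R N : set (borel_mx R N)).
Proof.
rewrite (_ : @orthogonal_mx R N = \bigcap_(ij in [set: 'I_N * 'I_N])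
  [set X : 'M[R]_N | (X *m X^T)%R ij.1 ij.2 = (1%:M : 'M[R]_N)%R ij.1 ij.2]).
  apply: fin_bigcap_measurable; first exact: finite_finset.
  move=> [i j] _ /=; apply: borel_mx_closed.
  apply: (@closed_comp _ _ (fun X : 'M[R]_N => (X *m X^T)%R i j : R^o)
    [set (1%:M : 'M[R]_N)%R i j]); last exact: closed_eq.
  move=> X _; apply: continuous_mulmx_entry => k l; first exact: entry_continuous.
  by under eq_fun do rewrite mxE; exact: entry_continuous.
apply/seteqP; split=> [X XX [i j] _ /=|X XX]; first by rewrite XX.
by apply/matrixP => i j; exact: (XX (i, j)).
Qed.

End borel_matrices.

(** * Generic frames for the Haar measure *)

Lemma negligible_bigcup_count (d : measure_display) (T : measurableType d)
    (R : realType) (mu : {measure set T -> \bar R}) (I : countType)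
    (F : I -> set T) :
  (forall i, mu.-negligible (F i)) -> mu.-negligible [set x | exists i, F i x].
Proof.
move=> F0; pose G (k : nat) := if unpickle k is Some i then F i else set0.
apply: (@negligibleS _ _ _ _ (\bigcup_k G k)).
  by move=> x [i Fix]; exists (pickle i) => //; rewrite /G pickleK.
apply: negligible_bigcup => k; rewrite /G.
by case: (unpickle k) => [i|]; [exact: F0|exact: negligible_set0].
Qed.

Section orthogonal.
Context (R : realType) (N : nat).
Implicit Types U P : 'M[R]_N.

Lemma orthogonal_mxC U : orthogonal_mx U -> (U^T *m U = 1%:M)%R.
Proof. exact: mulmx1C. Qed.

Lemma orthogonal_mx_tr U : orthogonal_mx U -> orthogonal_mx U^T%R.
Proof. by move=> UU; rewrite /orthogonal_mx /= trmxK; exact: orthogonal_mxC. Qed.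

Lemma orthogonal_mxM U P : orthogonal_mx U -> orthogonal_mx P ->
  orthogonal_mx (U *m P)%R.
Proof.
rewrite /orthogonal_mx /= => UU PP.
by rewrite trmx_mul mulmxA -[(_ *m _ *m P^T)%R]mulmxA PP mulmx1.
Qed.

Lemma orthogonal_mx_perm (s : 'S_N) : orthogonal_mx (perm_mx s : 'M[R]_N)%R.
Proof. by rewrite /orthogonal_mx /= tr_perm_mx -perm_mxM mulgV perm_mx1. Qed.

Lemma orthogonal_mx_entry_le U i j : orthogonal_mx U -> (`|U i j| <= 1)%R.
Proof.
move=> /matrixP/(_ i i); rewrite !mxE eqxx /= => rowi.
rewrite -(@ler_pXn2r _ 2)// ?nnegrE// expr1n real_normK ?num_real//.
rewrite -[leRHS]rowi (bigD1 j)//= mxE -expr2 lerDl sumr_ge0// => k _.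
by rewrite mxE -expr2 sqr_ge0.
Qed.

Lemma enorm_orthogonal U (x : 'rV[R]_N) : orthogonal_mx U ->
  enorm (x *m U)%R = enorm x.
Proof.
move=> UU; have E (y : 'rV[R]_N) : (\sum_(i < N) y ord0 i ^+ 2)%R =
    (y *m y^T)%R ord0 ord0.
  by rewrite mxE; apply: eq_bigr => i _; rewrite mxE expr2.
by rewrite /enorm !E trmx_mul mulmxA -[(_ *m _ *m U^T)%R]mulmxA UU mulmx1.
Qed.

End orthogonal.

Section haar.
Context (R : realType) (N : nat) (theta : probability (borel_mx R N) R).
Hypothesis haar : haar_orthogonal theta.
Implicit Types (A : set (borel_mx R N)) (U P Q : 'M[R]_N).

(** The preimage of a set under multiplication by orthogonal matrices is its image
    under multiplication by their transposes, to which invariance applies. *)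
Lemma haar_negligible A P Q : orthogonal_mx P -> orthogonal_mx Q ->
  theta.-negligible A ->
  theta.-negligible [set X : borel_mx R N | A (P *m (X : 'M[R]_N) *m Q)%R].
Proof.
move=> PP QQ [B [mB B0 AB]].
pose C := [set X : borel_mx R N | B ((X : 'M[R]_N) *m Q)%R].
have mC : measurable C.
  by rewrite (_ : C = [set X : borel_mx R N | B (1%:M *m (X : 'M[R]_N) *m Q)%R]);
    [exact: measurable_mulmx|under eq_set do rewrite mul1mx].
have CE : C = [set (X *m Q^T)%R | X in (B : set 'M[R]_N)].
  apply/seteqP; split=> [X BX|_ [X BX <-]].
    by exists (X *m Q)%R => //; rewrite -mulmxA QQ mulmx1.
  by rewrite /C /= -mulmxA orthogonal_mxC// mulmx1.
pose D := [set X : borel_mx R N | B (P *m (X : 'M[R]_N) *m Q)%R].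
have DE : D = [set (P^T *m X)%R | X in (C : set 'M[R]_N)].
  apply/seteqP; split=> [X BX|_ [X BX <-]].
    by exists (P *m X)%R => //; rewrite mulmxA orthogonal_mxC// mul1mx.
  by rewrite /D /= !mulmxA PP mul1mx.
exists D; split; [exact: measurable_mulmx| |by move=> X /AB].
rewrite DE (haar.2 _ _ (orthogonal_mx_tr PP) mC).1.
by rewrite CE (haar.2 _ _ (orthogonal_mx_tr QQ) mB).2.
Qed.

Definition near_frame U (delta : R) : set (borel_mx R N) :=
  [set g | orthogonal_mx (g : 'M[R]_N) /\
    forall i j, (`|(U *m (g : 'M[R]_N) - 1%:M) i j| < delta)%R].

Lemma rat_mx_dense (X : 'M[R]_N) (e : R) : (0 < e)%R ->
  exists Q : 'M[rat]_N, forall i j, (`|X i j - ratr (Q i j)| < e)%R.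
Proof.
move=> e0.
have /choice[f fP] : forall ij : 'I_N * 'I_N,
    exists q, (`|X ij.1 ij.2 - ratr q| < e)%R.
  move=> [i j] /=; have [q] := @rat_in_itvoo R (X i j - e) (X i j + e) ltac:(lra).
  rewrite in_itv /= => /andP[q1 q2]; exists q.
  by rewrite ltr_norml; apply/andP; split; lra.
by exists (\matrix_(i, j) f (i, j))%R => i j; rewrite mxE; exact: (fP (i, j)).
Qed.

(** Countably many translates of a neighbourhood cover the orthogonal group,
    because matrices with rational entries are dense; by invariance they would
    all be null. *)
Lemma near_frame_not_negligible U (delta : R) : orthogonal_mx U ->
  (0 < delta)%R -> ~ theta.-negligible (near_frame U delta).
Proof.
move=> UU d0 null.
(* Two orthogonal matrices within e of the same matrix differ by less than
   2 * e in each entry, and multiplying by an orthogonal matrix costs a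
   factor N. *)
pose e := (delta / (2 * N.+1%:R))%R.
have e0 : (0 < e)%R by rewrite divr_gt0// mulr_gt0.
pose c (Q : 'M[rat]_N) := [set X : borel_mx R N |
  orthogonal_mx (X : 'M[R]_N) /\
  forall i j, (`|(X : 'M[R]_N) i j - ratr (Q i j)| < e)%R].
suff : theta.-negligible [set X | exists Q : 'M[rat]_N, c Q X].
  move=> c0; have /negligibleP : theta.-negligible (@orthogonal_mx R N).
    apply: negligibleS c0 => X XX.
    by have [S XS] := rat_mx_dense X e0; exists S.
  move=> /(_ (@measurable_orthogonal_mx R N)) /(etrans (esym haar.1))/eqP.
  by rewrite onee_eq0.
apply: negligible_bigcup_count => S.
have [->|/set0P[P [PP Pc]]] := eqVneq (c S) set0; first exact: negligible_set0.
apply: negligibleS (haar_negligible (P := (U^T *m P^T)%R) (Q := 1%:M%R) _ _ null).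
- move=> X [XX Xc] /=; rewrite mulmx1; split.
    by apply: orthogonal_mxM => //; apply: orthogonal_mxM; exact: orthogonal_mx_tr.
  move=> i j; rewrite !mulmxA UU mul1mx.
  have -> : (P^T *m X - 1%:M = P^T *m (X - P))%R.
    by rewrite mulmxBr orthogonal_mxC.
  rewrite mxE; apply: le_lt_trans (ler_norm_sum _ _ _) _.
  apply: (@le_lt_trans _ _ (\sum_(k < N) (2 * e)))%R.
    apply: ler_sum => k _; rewrite normrM -[leRHS]mul1r ler_pM//.
      by rewrite mxE; exact: orthogonal_mx_entry_le.
    rewrite !mxE; have := Xc k j; have := Pc k j.
    rewrite !ltr_norml => /andP[p1 p2] /andP[x1 x2].
    by rewrite ler_norml; apply/andP; split; lra.
  rewrite sumr_const card_ord -[ltLHS]mulr_natr /e.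
  rewrite [X in (X < _)%R](_ : _ = delta * (N%:R / N.+1%:R))%R; last by field.
  by rewrite gtr_pMr// ltr_pdivrMr// mul1r ltr_nat.
- by apply: orthogonal_mxM; exact: orthogonal_mx_tr.
- by rewrite /orthogonal_mx /= trmx1 mulmx1.
Qed.

Definition good_plane (V : set 'rV[R]_N) (K n m : nat) (L : set 'rV[R]_N) :=
  ((m <= n)%N -> (path_components (V `&` L) #<= `I_K)%card) /\
  ((n < m)%N -> V `&` L = set0).

(** The null sets of frames that are exceptional for the leading columns are
    transported to the other subsets of columns by permutation matrices. Their
    union is null, so it cannot contain all the frames close to [U^T]. *)
Lemma generic_frame (K n : nat) (V : set 'rV[R]_N) U (delta : R) :
  regular_set theta K n V -> orthogonal_mx U -> (0 < delta)%R ->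
  exists g : 'M[R]_N, [/\ orthogonal_mx g,
    forall i j, (`|(U *m g - 1%:M) i j| < delta)%R &
    forall (s : 'S_N) (m : 'I_N.+1), vol [set b : 'rV[R]_m |
      ~ good_plane V K n m (plane ((g *m perm_mx s)%R : borel_mx R N,
        b : lebesgue_rV R m))] = 0].
Proof.
move=> [regK reg0] UU d0.
pose bad m : set (borel_mx R N) := [set g | vol [set b : 'rV[R]_m |
    ~ good_plane V K n m (plane ((g : borel_mx R N), (b : lebesgue_rV R m)))] <> 0].
have bad0 (m : 'I_N.+1) : theta.-negligible (bad m).
  apply: ae_grassmannian_frames; have mN : (m <= N)%N by rewrite -ltnS.
  have [mn|nm] := leqP m n.
    have [A [mA A0 PA]] := regK m mN mn; exists A; split=> // L bL.
    by apply: PA => LK; apply: bL; split=> //; rewrite ltnNge mn.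
  have [A [mA A0 PA]] := reg0 m mN nm; exists A; split=> // L bL.
  by apply: PA => L0; apply: bL; split=> //; rewrite leqNgt nm.
pose F (sm : 'S_N * 'I_N.+1) : set (borel_mx R N) :=
  [set X | bad sm.2 (1%:M *m (X : 'M[R]_N) *m perm_mx sm.1)%R].
have F0 : theta.-negligible [set X | exists sm, F sm X].
  apply: negligible_bigcup_count => -[s m].
  apply: haar_negligible (bad0 m); last exact: orthogonal_mx_perm.
  by rewrite /orthogonal_mx /= trmx1 mulmx1.
have : ~ (near_frame U delta `<=` [set X | exists sm, F sm X]).
  by move=> /negligibleS/(_ F0); exact: near_frame_not_negligible.
move=> /existsNP[g /not_implyP[[gg gU] gF]]; exists g; split=> // s m.
by apply: contrapT => gsm; apply: gF; exists (s, m); rewrite /F /= mul1mx.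
Qed.

End haar.

(** * Generic offsets *)

Lemma vol_exists_count0 (R : realType) (N : nat) (I : countType)
    (F : I -> set 'rV[R]_N) :
  (forall i, vol (F i) = 0) -> vol [set x | exists i, F i x] = 0.
Proof.
move=> F0; apply/eqP; rewrite eq_le outer_measure_ge0 andbT.
pose G (k : nat) := if unpickle k is Some i then F i else set0.
apply: (@le_trans _ _ (vol (\bigcup_k G k))).
  apply: le_outer_measure => x [i Fix]; exists (pickle i) => //.
  by rewrite /G pickleK.
apply: le_trans (outer_measure_sigma_subadditive _ _) _.
rewrite eseries0// => k _ _; rewrite /G.
by case: (unpickle k) => [i|]; [exact: F0|exact: outer_measure0].
Qed.

Lemma uniq_prefix_perm (N : nat) (s : seq 'I_N) : uniq s ->
  exists f : 'S_N, forall i : 'I_N, (i < size s)%N -> f i = nth i s i.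
Proof.
move=> us; pose t := s ++ [seq i <- enum 'I_N | i \notin s].
have ut : uniq t.
  rewrite cat_uniq us filter_uniq ?enum_uniq// andbT -all_predC.
  by apply/allP => i; rewrite mem_filter => /andP[].
have tN : size t = N.
  rewrite -[RHS](card_ord N) cardE; apply/perm_size/uniq_perm => //.
    exact: enum_uniq.
  move=> i; rewrite mem_cat mem_filter mem_enum inE andbT.
  by case: (i \in s).
have f_inj : injective (fun i : 'I_N => nth i t i).
  move=> i j /eqP; rewrite (set_nth_default i j) ?tN//.
  by rewrite nth_uniq ?tN// => /eqP/val_inj.
by exists (perm f_inj) => i si; rewrite permE nth_cat si.
Qed.

Section generic_grid.
Context (R : realType) (N K n M : nat) (V : set 'rV[R]_N) (g : 'M[R]_N) (h : R).

Local Notation a := (fun (i : 'I_N) (x : 'rV[R]_N) => (x *m g)%R ord0 i).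

Hypothesis g_generic : forall (s : 'S_N) (m : 'I_N.+1), vol [set b : 'rV[R]_m |
  ~ good_plane V K n m (plane ((g *m perm_mx s)%R : borel_mx R N,
    b : lebesgue_rV R m))] = 0.

(** The hyperplanes of [u] intersect in a plane whose normals are distinct columns
    of [g], and whose offset is a translate of a projection of [b]. *)
Lemma bad_offsets0 (q : 'rV[R]_N * 'rV[R]_N)
    (u : seq ('I_N * ('I_M * bool))) : uniq (map fst u) ->
  vol (box q `&` [set b : 'rV[R]_N | ~ good_plane V K n (size u)
    (grid_plane a (b ord0) h u)]) = 0.
Proof.
move=> uu; have [f fP] := uniq_prefix_perm uu.
have uN : (size u < N.+1)%N.
  rewrite ltnS -(size_map fst) -[leqRHS](card_ord N) -(card_uniqP uu).
  exact: max_card.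
pose p j := tnth (in_tuple u) j.
pose shift := (\row_(j < size u) (((p j).2.1 + (p j).2.2)%:R * h))%R.
have pE d j : (p j).1 = nth d (map fst u) j.
  by rewrite (nth_map (p j))// -(tnth_nth (p j) (in_tuple u)).
have p_inj : injective (fun j : 'I_(size u) => (p j).1).
  move=> j k /eqP; rewrite (pE (p j).1 j) (pE (p j).1 k).
  by rewrite nth_uniq ?size_map// => /eqP/val_inj.
rewrite -[RHS](vol_cylinder0 shift p_inj q (g_generic f^-1%g (Ordinal uN))).
congr (vol (_ `&` _)); apply/seteqP.
suff planeE b : grid_plane a ((b : 'rV[R]_N) ord0) h u =
    plane ((g *m perm_mx f^-1%g)%R : borel_mx R N,
      (\row_j b ord0 (p j).1 + shift)%R : lebesgue_rV R (size u)).
  by split=> b /=; rewrite planeE.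
have fE (i : 'I_N) (j : 'I_(size u)) : i = j :> nat -> f i = (p j).1.
  move=> ij; rewrite fP; last by rewrite ij size_map.
  by rewrite ij (pE i).
apply/seteqP; split=> x /= xu.
  move=> i j ij; rewrite mulmxA -col_permE mxE (fE i j ij) xu ?mem_tnth//.
  by rewrite !mxE.
move=> pk pku; have /tnthP[j ->] : pk \in in_tuple u by [].
have jN : (j < N)%N by apply: leq_trans (ltn_ord j) _.
have := xu (Ordinal jN) j erefl.
by rewrite mulmxA -col_permE mxE (fE (Ordinal jN) j)// => ->; rewrite !mxE.
Qed.

Lemma generic_offset (q : 'rV[R]_N * 'rV[R]_N) :
  (forall i, q.1 ord0 i < q.2 ord0 i)%R ->
  exists2 b : 'rV[R]_N, box q b & grid_regular V a (b ord0) h M K n.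
Proof.
move=> q12; apply: contrapT => nob.
have : vol (box q) = 0.
  rewrite -[RHS](@vol_exists_count0 R N _ (fun u : seq ('I_N * ('I_M * bool)) =>
    if uniq (map fst u) then box q `&` [set b : 'rV[R]_N |
      ~ good_plane V K n (size u) (grid_plane a (b ord0) h u)] else set0)).
    congr vol; apply/seteqP; split=> [b qb|b [u]].
      apply: contrapT => /forallNP goodb; apply: nob; exists b => // u uu.
      have := goodb u; rewrite uu => /not_andP[//|].
      exact: contrapT.
    by case: ifP => // _ [].
  move=> u; case: ifP => [uu|_]; first exact: bad_offsets0.
  exact: outer_measure0.
move=> /eqP; apply/negP; rewrite gt_eqF//.
apply: (@lt_le_trans _ _ (box_vol q)).
  by rewrite lte_fin prodr_gt0// => i _; rewrite lt_max subr_gt0 q12 orbT.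
by apply: box_vol_le_vol => // i; rewrite ltW.
Qed.

End generic_grid.

(** * The covering number of a regular set *)

Section covering_bound.
Context (R : realType) (N : nat).
Implicit Types (V : set 'rV[R]_N) (U g : 'M[R]_N) (r t eps : R).

Lemma enorm_le_entries (x : 'rV[R]_N) r : (0 <= r)%R ->
  (forall i, `|x ord0 i| <= r)%R -> (enorm x <= r * Num.sqrt N%:R)%R.
Proof.
move=> r0 xr; rewrite enorm_le ?mulr_ge0//.
rewrite exprMn sqr_sqrtr// mulr_natr -[in leRHS](card_ord N) -sumr_const.
apply: ler_sum => i _; rewrite -(real_normK (num_real (x ord0 i))).
by rewrite ler_pXn2r// nnegrE.
Qed.

Definition in_cube V r U (v : 'rV[R]_N) : Prop :=
  orthogonal_mx U /\ V `<=` [set (x *m U + v)%R | x in cube r].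

Lemma cube_radius_lt V t r : cube_radius V <= t%:E -> (t < r)%R ->
  exists s U v, [/\ (0 <= s)%R, (s < r)%R & in_cube V s U v].
Proof.
move=> Vt tr; have : cube_radius V < r%:E by rewrite (le_lt_trans Vt)// lte_fin.
move=> /ereal_inf_lt[_ [s [s0 [U [v [UU sV]]]] <-]]; rewrite lte_fin => sr.
by exists s, U, v; split.
Qed.

Lemma ediam_le_cube V r U (v : 'rV[R]_N) : (0 <= r)%R -> in_cube V r U v ->
  ediam V <= (2 * r * Num.sqrt N%:R)%:E.
Proof.
move=> r0 [UU rV]; apply: ge_ereal_sup => _ [[_ _] /= [/rV[x xr <-] /rV[y yr <-]] <-].
rewrite lee_fin (_ : _ - _ = (x - y) *m U)%R; last first.
  by rewrite mulmxBl opprD addrACA subrr addr0.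
rewrite enorm_orthogonal//; apply: enorm_le_entries => [|i].
  by rewrite mulr_ge0.
rewrite !mxE (le_trans (ler_normB _ _))// mulrDl mul1r.
by apply: lerD; [exact: (xr i)|exact: (yr i)].
Qed.

(** A coordinate along [g] is a coordinate along the axes of the cube plus [N] error
    terms, each at most [r / (2 * (N + 1))]. *)
Lemma in_cube_near_frame V r U (v : 'rV[R]_N) g (x : 'rV[R]_N) i :
  (0 <= r)%R -> in_cube V r U v ->
  (forall i j, `|(U *m g - 1%:M) i j| < (2 * N.+1%:R)^-1)%R -> V x ->
  (`|(x *m g)%R ord0 i - (v *m g)%R ord0 i| <= 3 / 2 * r)%R.
Proof.
move=> r0 [UU rV] gU /rV[c cr <-].
have -> : (((c *m U + v) *m g) ord0 i - (v *m g) ord0 i =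
    c ord0 i + (c *m (U *m g - 1%:M)) ord0 i)%R.
  by rewrite mulmxDl mulmxBr mulmx1 mulmxA !mxE; ring.
apply: le_trans (ler_normD _ _) _.
suff : (`|(c *m (U *m g - 1%:M))%R ord0 i| <= r / 2)%R.
  by have := cr i; lra.
rewrite mxE; apply: le_trans (ler_norm_sum _ _ _) _.
apply: (@le_trans _ _ (\sum_(k < N) (r * (2 * N.+1%:R)^-1)))%R.
  apply: ler_sum => k _; rewrite normrM ler_pM//; exact: ltW.
rewrite sumr_const card_ord -[leLHS]mulr_natr -mulrA ler_wpM2l//.
by rewrite invfM -mulrA ler_piMr// mulrC ler_pdivrMr// mul1r ler_nat.
Qed.

(** As the covering number is compared with a power of [t / eps], the rounding
    errors in the number of cells have to be absorbed: the assumption on the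
    diameter gives [eps <= 2 * t * sqrt N]. *)
Lemma covering_number_le (theta : probability (borel_mx R N) R) (K n : nat) V
    t eps :
  haar_orthogonal theta -> regular_set theta K n V -> cube_radius V <= t%:E ->
  (0 < eps)%R -> eps%:E <= ediam V ->
  covering_number V eps <=
    (K%:R * (22 * t * (N%:R * Num.sqrt N%:R) / eps) ^+ n)%R%:E.
Proof.
move=> haar reg Vt e0 eV.
have diam_le s : (t < s)%R -> exists2 r, (0 <= r < s)%R &
    (exists U v, in_cube V r U v) /\ (eps <= 2 * r * Num.sqrt N%:R)%R.
  move=> /(cube_radius_lt Vt)[r [U [v [r0 rs rV]]]]; exists r; first by rewrite r0.
  split; first by exists U, v.
  by rewrite -lee_fin (le_trans eV)// (ediam_le_cube r0 rV).
have N0 : (0 < N)%N.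
  have [r _ [_]] := diam_le (t + 1)%R ltac:(lra).
  by case: N => //; rewrite sqrtr0 mulr0 leNgt e0.
have sN0 : (0 < Num.sqrt N%:R :> R)%R by rewrite sqrtr_gt0 ltr0n.
have et : (eps <= 2 * t * Num.sqrt N%:R)%R.
  rewrite leNgt; apply/negP => te.
  have [|r /andP[_ rs] [_]] := diam_le (eps / (2 * Num.sqrt N%:R))%R.
    by rewrite ltr_pdivlMr ?mulr_gt0//; move: te; lra.
  move: rs; rewrite ltr_pdivlMr ?mulr_gt0//; lra.
have t0 : (0 < t)%R.
  have : (0 < 2 * t * Num.sqrt N%:R)%R by exact: lt_le_trans et.
  by rewrite pmulr_lgt0// pmulr_rgt0.
(* The infimum defining the radius is only approached: a cube of half-side less
   than 2 * t is enough, and turning the frame costs another factor 3 / 2. *)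
have [r /andP[r0 rt] [[U [v rV]] _]] := diam_le (2 * t)%R ltac:(lra).
have d0 : (0 < (2 * N.+1%:R)^-1 :> R)%R by rewrite invr_gt0 mulr_gt0.
have [g [gg gU g_generic]] := generic_frame haar reg rV.1 d0.
pose h := (eps / Num.sqrt N%:R)%R.
have h0 : (0 < h)%R by rewrite divr_gt0.
pose M := (Num.truncn (6 * t / h)).+2.
(* Any b in this box lies below all the coordinates of V, by at most 6 * t + h;
   M layers of height h suffice. *)
pose q := (v *m g - const_mx (3 * t + h), v *m g - const_mx (3 * t))%R.
have [|b qb b_reg] := @generic_offset R N K n M V g h g_generic q.
  by move=> i; rewrite !mxE; lra.
pose a (i : 'I_N) (x : 'rV[R]_N) := (x *m g)%R ord0 i.
have a_cont i : continuous (a i : 'rV[R]_N -> R^o).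
  apply: continuous_mulmx_entry => k l; first exact: entry_continuous.
  by move=> ?; exact: cst_continuous.
have x0 : (0 <= 6 * t / h)%R by rewrite divr_ge0 ?(ltW h0)// mulr_ge0// ltW.
apply: (@le_trans _ _ (#|hit_cells V a (b ord0) h M|%:R : R)%:E).
  apply: covering_number_le_hit_cells => // [x i Vx|x y xy].
    have := in_cube_near_frame i r0 rV gU Vx.
    have := qb i; rewrite /a !mxE => /andP[b1 b2].
    rewrite ler_norml => /andP[a1 a2]; apply/andP; split; first by lra.
    have := truncnS_gt (6 * t / h)%R; rewrite ltr_pdivrMr// => hM.
    have -> : (M%:R * h = (Num.truncn (6 * t / h)).+1%:R * h + h)%R.
      by rewrite /M -natr1 mulrDl mul1r.
    lra.
  rewrite -(enorm_orthogonal _ gg).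
  have -> : eps = (h * Num.sqrt N%:R)%R by rewrite /h divfK ?gt_eqF.
  apply: enorm_le_entries => [|i]; first exact: ltW.
  by rewrite mulmxBl !mxE; have := xy i; rewrite /a !mxE.
rewrite lee_fin.
apply: (@le_trans _ _ ((N * (M * 2)).+1 ^ n * K)%:R)%R.
  by rewrite ler_nat; exact: card_hit_cells.
rewrite natrM natrX mulrC ler_wpM2l// lerXn2r ?nnegrE//.
  by rewrite divr_ge0 ?(ltW e0)// !mulr_ge0 ?(ltW t0).
pose X := (t * Num.sqrt N%:R / eps)%R.
have X1 : (1 <= 2 * X)%R by rewrite /X !mulrA ler_pdivlMr// mul1r; move: et; lra.
have MX : (M%:R <= 6 * X + 2)%R.
  rewrite /M -addn2 natrD lerD2r; apply: le_trans (_ : 6 * t / h <= _)%R.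
    by rewrite truncn_le.
  by rewrite /X /h invf_div !mulrA.
have -> : (22 * t * (N%:R * Num.sqrt N%:R) / eps = N%:R * (22 * X))%R.
  by rewrite /X; ring.
have N1 : (1 <= N%:R :> R)%R by rewrite ler1n.
rewrite -natr1 !natrM.
have : (N%:R * (M%:R * 2) <= N%:R * (12 * X + 4))%R.
  by rewrite ler_wpM2l//; move: MX; lra.
have : (N%:R * 1 <= N%:R * (2 * X))%R by rewrite ler_wpM2l.
lra.
Qed.

End covering_bound.

Theorem corollary2p19 (R : realType) :
  exists2 c : R, (0 < c)%R &
    forall (N : nat) (theta : probability (borel_mx R N) R),
      haar_orthogonal theta ->
    forall (K n : nat) (V : set 'rV[R]_N) (t : R),
      regular_set theta K n V ->
      cube_radius V <= t%:E ->
    forall eps : R, (0 < eps)%R ->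
      vol (tube V eps) <=
        covering_number V eps * ((2 * eps) ^+ N)%R%:E *
        vol (eball (0 : 'rV[R]_N)%R 1) /\
      (eps%:E <= ediam V ->
       covering_number V eps * ((2 * eps) ^+ N)%R%:E *
         vol (eball (0 : 'rV[R]_N)%R 1) <=
       vol (eball (0 : 'rV[R]_N)%R 1) *
         (2 ^+ N * eps ^ (N%:Z - n%:Z) * K%:R *
          (c * t * N%:R `^ (3 / 2) * n%:R) ^+ n)%R%:E).
Proof.
exists 22%R => // N theta haar K n V t reg Vt eps e0; split.
  exact: vol_tube_le.
move=> eV; rewrite muleC lee_wpmul2l ?outer_measure_ge0//.
have := covering_number_le haar reg Vt e0 eV.
have t0 : (0 <= t)%R.
  rewrite -lee_fin; apply: le_trans Vt.
  by apply: le_ereal_inf_tmp => _ [r [r0 _] <-]; rewrite lee_fin.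
have e20 : 0 <= ((2 * eps) ^+ N)%:E.
  by rewrite lee_fin exprn_ge0// mulr_ge0// ltW.
move=> /(lee_wpmul2r e20)/le_trans; apply.
have N32 : (N%:R `^ (3 / 2) = N%:R * Num.sqrt N%:R :> R)%R.
  rewrite (_ : 3 / 2 = 1 + 2^-1)%R; last by field.
  by rewrite powRD ?powRr1 ?powR12_sqrt//; apply/implyP => /eqP; lra.
rewrite -EFinM lee_fin N32; set Y := (22 * t * (N%:R * _))%R.
have Y0 : (0 <= Y)%R by rewrite !mulr_ge0.
have -> : (K%:R * (Y / eps) ^+ n * (2 * eps) ^+ N =
    2 ^+ N * eps ^ (N%:Z - n%:Z) * K%:R * Y ^+ n)%R.
  rewrite expfzDr ?gt_eqF// -exprnN -exprnP expr_div_n.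
  by rewrite (exprMn N); ring.
rewrite ler_wpM2l//.
  by rewrite !mulr_ge0// ?exprn_ge0// exprz_ge0// ltW.
have [->|n0] := posnP n; first by rewrite !expr0.
by rewrite lerXn2r ?nnegrE ?mulr_ge0// ler_peMr// ler1n.
Qed.
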